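(* Let $\alpha>0$, $\rho>0$ and $0\le a<b\le1$, and set $c:=(1-a^\rho)^{1/\rho}$ and $s:=(1-b^\rho)^{1/\rho}$. Let $(M,d)$ be a global NPC space, $K\subseteq M$ a convex set, $h:\mathbb{R}\to(0,\infty)$ a function, and $f:K\to\mathbb{R}$ a geodesically $h$-convex function. Let $\gamma:[0,1]\to K$ be a geodesic, and assume that the fractional integrals appearing below exist. Put $F(u):=f(\gamma(u^\rho))$ and $H(u):=h(u^\rho)$ for $u\in[0,1]$. Then $$f\left(\gamma\left(\tfrac12\right)\right)\le\frac{\rho^\alpha\,\Gamma(\alpha+1)}{(b^\rho-a^\rho)^\alpha}\,h\left(\tfrac12\right)\Big({}^\rho I^\alpha_{a+}F(b)+{}^\rho I^\alpha_{c-}F(s)\Big)$$ and $$\frac{\rho^\alpha\,\Gamma(\alpha+1)}{(b^\rho-a^\rho)^\alpha}\,h\left(\tfrac12\right)\Big({}^\rho I^\alpha_{a+}F(b)+{}^\rho I^\alpha_{c-}F(s)\Big)\le\frac{f(\gamma(0))+f(\gamma(1))}{(b^\rho-a^\rho)^\alpha}\,\rho^\alpha\,\Gamma(\alpha+1)\,h\left(\tfrac12\right)\Big({}^\rho I^\alpha_{a+}H(b)+{}^\rho I^\alpha_{c-}H(s)\Big).$$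
   Context: A geodesic $\gamma:[0,1]\to M$ in a metric space $(M,d)$ is a shortest curve parametrized proportionally to arc length: $d(\gamma(s),\gamma(t))=|s-t|\,d(\gamma(0),\gamma(1))$ for all $s,t\in[0,1]$. A metric space $(M,d)$ is a global NPC space if (1) each pair of points can be connected by a geodesic, and (2) for all $x_0,x_1\in M$ there exists $y\in M$ such that for all $p\in M$, $d^2(p,y)\le\frac12\big(d^2(p,x_0)+d^2(p,x_1)\big)-\frac14 d^2(x_0,x_1)$. A subset $K\subseteq M$ is convex if for each geodesic $\gamma:[0,1]\to M$ joining two arbitrary points of $K$ one has $\gamma([0,1])\subseteq K$. For $h:\mathbb{R}\to(0,\infty)$, a function $f:K\to\mathbb{R}$ is geodesically $h$-convex if for every geodesic $\gamma:[0,1]\to K$ and all $t\in[0,1]$, $f(\gamma(t))\le h(1-t)f(\gamma(0))+h(t)f(\gamma(1))$. Katugampola fractional integrals of order $\alpha>0$ with parameter $\rho>0$: for a function $g$, $${}^\rho I^\alpha_{a+}g(x)=\frac{\rho^{1-\alpha}}{\Gamma(\alpha)}\int_a^x\frac{t^{\rho-1}}{(x^\rho-t^\rho)^{1-\alpha}}g(t)\,dt,\qquad {}^\rho I^\alpha_{c-}g(x)=\frac{\rho^{1-\alpha}}{\Gamma(\alpha)}\int_x^c\frac{t^{\rho-1}}{(t^\rho-x^\rho)^{1-\alpha}}g(t)\,dt,$$ provided the integrals exist. $\Gamma$ is Euler's gamma function. *)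

(* Defs.v *)
From HB Require Import structures.
From mathcomp Require Import all_boot all_order all_algebra.
From mathcomp Require Import all_classical all_reals all_analysis.

Set Implicit Arguments.
Unset Strict Implicit.
Unset Printing Implicit Defensive.

Import Order.TTheory GRing.Theory Num.Theory.
Import numFieldNormedType.Exports.

Local Open Scope classical_set_scope.
Local Open Scope ring_scope.

Section GlobalNPC.
Context {R : realType} {M : metricType R}.
Implicit Types (gamma : R -> M) (K : set M).

(* A curve [0, 1] -> M is a function on the whole of R whose values outside
   [0, 1] are never looked at. *)
Definition geodesic gamma : Prop :=
  forall s t, s \in `[0, 1] -> t \in `[0, 1] ->
    mdist (gamma s) (gamma t) = `|s - t| * mdist (gamma 0) (gamma 1).

Definition curve_in K gamma : Prop :=
  forall t, t \in `[0, 1] -> K (gamma t).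

Definition geodesically_convex K : Prop :=
  forall gamma, geodesic gamma -> K (gamma 0) -> K (gamma 1) ->
    curve_in K gamma.

(* A function K -> R is a function on M whose values outside K are never
   looked at. *)
Definition geodesically_hconvex (h : R -> R) K (f : M -> R) : Prop :=
  forall gamma, geodesic gamma -> curve_in K gamma ->
    forall t, t \in `[0, 1] ->
      f (gamma t) <= h (1 - t) * f (gamma 0) + h t * f (gamma 1).

End GlobalNPC.

Definition global_NPC {R : realType} (M : metricType R) : Prop :=
  (forall x0 x1 : M, exists gamma : R -> M,
     [/\ geodesic gamma, gamma 0 = x0 & gamma 1 = x1]) /\
  (forall x0 x1 : M, exists y : M, forall p : M,
     mdist p y ^+ 2 <=
       2^-1 * (mdist p x0 ^+ 2 + mdist p x1 ^+ 2) - 4^-1 * mdist x0 x1 ^+ 2).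

Section Katugampola.
Context {R : realType}.
Implicit Types (rho alpha a c x : R) (g : R -> R).

Definition Gamma (z : R) : R :=
  \int[lebesgue_measure]_(t in `]0, +oo[) (t `^ (z - 1) * expR (- t)).

(* The integrals are taken with respect to the completed measure, so that g is
   only required to be Lebesgue measurable ([lebesgue_measure] would ask for
   Borel measurability). *)
Notation leb := (@completed_lebesgue_measure R).

Definition katugampola_left_integrand rho alpha g x (t : R) : R :=
  t `^ (rho - 1) / (x `^ rho - t `^ rho) `^ (1 - alpha) * g t.

Definition katugampola_right_integrand rho alpha g x (t : R) : R :=
  t `^ (rho - 1) / (t `^ rho - x `^ rho) `^ (1 - alpha) * g t.

Definition katugampola_left_exists rho alpha a g x : Prop :=
  leb.-integrable `[a, x] (EFin \o katugampola_left_integrand rho alpha g x).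

Definition katugampola_right_exists rho alpha c g x : Prop :=
  leb.-integrable `[x, c] (EFin \o katugampola_right_integrand rho alpha g x).

Definition katugampola_left rho alpha a g x : R :=
  rho `^ (1 - alpha) / Gamma alpha *
  \int[leb]_(t in `[a, x]) katugampola_left_integrand rho alpha g x t.

Definition katugampola_right rho alpha c g x : R :=
  rho `^ (1 - alpha) / Gamma alpha *
  \int[leb]_(t in `[x, c]) katugampola_right_integrand rho alpha g x t.

End Katugampola.

(* Main.v *)
(** Write [phi x = f (gamma x)] and substitute [x = t `^ rho].  The map
    [t |-> (1 - t `^ rho) `^ rho^-1] carries ]a, b[ onto ]s, c[, reverses the
    order, and turns the weight of the right-sided integral into that of the
    left-sided one.  Hence the sum of the two integrals is
      [rho `^ (1 - alpha) / Gamma alpha * \int_(t in ]a, b[)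
         w t * (phi (t `^ rho) + phi (1 - t `^ rho))],
      [w t = t `^ (rho - 1) * (b `^ rho - t `^ rho) `^ (alpha - 1)],
    and both inequalities hold pointwise under the integral sign: [gamma 2^-1]
    is the midpoint of the geodesic from [gamma x] to [gamma (1 - x)], and
    [gamma x], [gamma (1 - x)] lie on the geodesic [gamma].  The constants
    match because [w] has total mass
    [(b `^ rho - a `^ rho) `^ alpha / (alpha * rho)] and
    [Gamma (alpha + 1) = alpha * Gamma alpha].  As [h] and [f] are only
    Lebesgue measurable along [gamma], the substitution must be done for the
    completed Lebesgue measure. *)
Require Import Defs.
From HB Require Import structures.
From mathcomp Require Import all_boot all_order all_algebra.
From mathcomp Require Import all_classical all_reals all_analysis.
From mathcomp Require Import measurable_realfun ring lra.

Set Implicit Arguments.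
Unset Strict Implicit.
Unset Printing Implicit Defensive.

Import Order.TTheory GRing.Theory Num.Theory.
Import numFieldNormedType.Exports.

Local Open Scope classical_set_scope.
Local Open Scope ring_scope.

(** * Change of variables for Borel functions *)

Section density.
Local Open Scope ereal_scope.
Context d (T : measurableType d) (R : realType) (mu : {measure set T -> \bar R}).
Variable w : T -> R.
(** The proofs that [w] is measurable and nonnegative are arguments, so that the measure structure
    declared below can be inferred from the term alone. *)
Definition density_measure of measurable_fun setT w & (forall x, (0 <= w x)%R) :=
  fun A : set T => \int[mu]_(x in A) (w x)%:E.

Hypotheses (mw : measurable_fun setT w) (w0 : forall x, (0 <= w x)%R).

Local Notation density := (density_measure mw w0).

Let density0 : density set0 = 0.
Proof. by rewrite /density_measure integral_set0. Qed.

Let mwE : measurable_fun setT (EFin \o w).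
Proof. exact/measurable_EFinP. Qed.

Let wE0 x : 0 <= (w x)%:E.
Proof. by rewrite lee_fin. Qed.

Let density_ge0 A : 0 <= density A.
Proof. exact: integral_ge0. Qed.

Let density_sigma_additive : semi_sigma_additive density.
Proof.
move=> F mF tF mUF; rewrite /density_measure; apply: cvg_toP.
  apply: ereal_nondecreasing_is_cvgn => m n mn.
  by apply: lee_sum_nneg_natr => // k _ _; exact: integral_ge0.
by rewrite ge0_integral_bigcup//; exact: measurable_funTS.
Qed.

HB.instance Definition _ := isMeasure.Build _ _ _
  density density0 density_ge0 density_sigma_additive.

Let integral_density_indic (E : set T) : measurable E ->
  \int[density]_x (\1_E x)%:E = \int[mu]_x ((\1_E x)%:E * (w x)%:E).
Proof.
move=> mE; rewrite integral_indic// setIT /density_measure [LHS]integral_mkcond.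
apply: eq_integral => x _; rewrite patchE indicE.
by case: (x \in E); rewrite ?mul1e ?mul0e.
Qed.

Import HBNNSimple.

Let integral_density_nnsfun (f : {nnsfun T >-> R}) :
  \int[density]_x (f x)%:E = \int[mu]_x ((f x)%:E * (w x)%:E).
Proof.
under [LHS]eq_integral do rewrite fimfunE -fsumEFin//.
rewrite [LHS]ge0_integral_fsum//; last 2 first.
  - by move=> r; exact/measurable_EFinP/measurableT_comp.
  - by move=> n x _; rewrite EFinM nnfun_muleindic_ge0.
under [RHS]eq_integral.
  move=> x xD; rewrite fimfunE -fsumEFin// muleC ge0_mule_fsumr; last first.
    by move=> r; rewrite EFinM nnfun_muleindic_ge0.
  over.
rewrite [RHS]ge0_integral_fsum//; last 2 first.
  - move=> r; apply: emeasurable_funM => //.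
    by apply/measurable_EFinP/measurable_funM.
  - by move=> n x _; apply: mule_ge0 => //; rewrite EFinM nnfun_muleindic_ge0.
apply: eq_fsbigr => r _.
rewrite integralZl_indic_nnsfun//= integral_density_indic//.
(* A nonnegative simple function never takes a negative value [r], so that both sides vanish in that
   case. *)
have [r0|r0] := leP 0%R r; last first.
  rewrite (preimage_nnfun0 _ r0).
  rewrite [X in _ * X]integral0_eq ?mule0; last first.
    by move=> x _; rewrite indicE in_set0 mul0e.
  by rewrite integral0_eq// => x _; rewrite indicE in_set0 mulr0 mule0.
rewrite -ge0_integralZl//.
- by apply: eq_integral => x _; rewrite EFinM muleA muleC.
- by apply: emeasurable_funM => //; exact/measurable_EFinP.
- by move=> x _; rewrite mule_ge0// lee_fin.
Qed.

(** For indicators this is the definition of the density measure; linearity extends it to simple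
    functions, and monotone convergence along [nnsfun_approx] to all nonnegative measurable
    functions. *)
Lemma ge0_integral_density (f : T -> \bar R) :
  measurable_fun setT f -> (forall x, 0 <= f x) ->
  \int[density]_x f x = \int[mu]_x (f x * (w x)%:E).
Proof.
move=> mf f0.
pose f_ := nnsfun_approx measurableT mf.
transitivity (lim (\int[density]_x (f_ n x)%:E @[n --> \oo])).
  rewrite -monotone_convergence//=.
  - apply: eq_integral => ? /[!inE] xD; apply/esym/cvg_lim => //=.
    exact: cvg_nnsfun_approx.
  - by move=> n; exact/measurable_EFinP/measurable_funTS.
  - by move=> n ? _; rewrite lee_fin.
  - by move=> ? _ ? ? mn; rewrite lee_fin; exact/lefP/nd_nnsfun_approx.
under eq_fun do rewrite integral_density_nnsfun.
rewrite -monotone_convergence//=.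
- apply: eq_integral => x _; apply/cvg_lim => //.
  by apply: cvgeZr => //; exact: cvg_nnsfun_approx.
- by move=> n; apply: emeasurable_funM => //; exact/measurable_EFinP.
- by move=> n x _; rewrite mule_ge0// lee_fin.
- move=> x _ m n mn; rewrite lee_wpmul2r// lee_fin.
  exact/lefP/nd_nnsfun_approx.
Qed.

End density.

(** * Decreasing substitutions for Lebesgue measure *)

Section decreasing_substitution.
Local Open Scope ereal_scope.
Context {R : realType}.
Notation mu := (@lebesgue_measure R).
Implicit Types (psi j : R -> R) (g : R -> \bar R).

(* The push-forward by [psi] of the measure with density [j] on [[a, b]] and
   Lebesgue measure on [[psi b, psi a]] agree on the rays ]x, +oo[. *)
Lemma ge0_decreasing_substitution_cc psi j g (a b : R) : (a < b)%R ->
  measurable_fun setT psi ->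
  {in `[a, b], forall t : R, is_derive t (1%R : R) psi (- j t)%R} ->
  {in `[a, b], continuous j} -> {in `[a, b], forall t, (0 < j t)%R} ->
  measurable_fun `[psi b, psi a] g -> {in `[psi b, psi a], forall x, 0 <= g x} ->
  \int[mu]_(x in `[psi b, psi a]) g x =
  \int[mu]_(t in `[a, b]) (g (psi t) * (j t)%:E).
Proof.
move=> ab mpsi dpsi cj j0 mg g0.
have mpsiI (A : set R) : measurable A -> measurable (psi @^-1` A).
  by move=> mA; rewrite -[X in measurable X]setTI; exact: mpsi.
have cpsi : {within `[a, b], continuous psi}.
  by apply: derivable_within_continuous => t /dpsi [].
have decr x y : x \in `[a, b] -> y \in `[a, b] -> (x < y)%R -> (psi y < psi x)%R.
  rewrite !in_itv/= => /andP[ax _] /andP[_ yb] xy.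
  apply: (@ltr0_derive1_decr _ psi a b) => // t tab.
    by have [] := dpsi _ (subset_itv_oo_cc tab).
  have := dpsi _ (subset_itv_oo_cc tab) => dt.
  by rewrite derive1E derive_val oppr_lt0 j0// (subset_itv_oo_cc tab).
(* [- psi] is an antiderivative of [j], so the mass that the density gives to an interval is a
   difference of values of [psi]. *)
have FTC x y : x \in `[a, b] -> y \in `[a, b] -> (x <= y)%R ->
    \int[mu]_(t in `[x, y]) (j t)%:E = (psi x - psi y)%:E.
  move=> xab yab; rewrite le_eqVlt => /predU1P[->|xy].
    by rewrite set_itv1 integral_set1 subrr.
  have sub : `[x, y]%classic `<=` `[a, b]%classic.
    by apply: subset_itvScc; rewrite bnd_simp ?(itvP xab) ?(itvP yab).
  rewrite (@continuous_FTC2 _ j (fun t => - psi t)%R x y xy).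
  - by rewrite -EFinB opprK addrC.
  - by apply: continuous_in_subspaceT => t /[!inE] /sub/cj.
  - have cN : {within `[x, y], continuous (fun t => - psi t)%R}.
      move=> t; apply: continuousN.
      exact: (continuous_subspaceW sub cpsi).
    split; last 2 first.
    + by have /(continuous_within_itvP _ xy)[] := cN.
    + by have /(continuous_within_itvP _ xy)[] := cN.
    + move=> t /subset_itv_oo_cc /sub /dpsi dt; exact: derivableN.
  - move=> t /subset_itv_oo_cc /sub /dpsi dt.
    by rewrite derive1E deriveN// derive_val opprK.
have aab : a \in `[a, b] by rewrite in_itv/= lexx ltW.
have bab : b \in `[a, b] by rewrite in_itv/= lexx ltW.
(* [density_measure] asks for a density that is measurable and nonnegative on the whole line, hence
   the extension of [j] by zero. *)
pose w := (j \_ `[a, b])%R.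
have mw : measurable_fun setT w.
  apply/measurable_restrict => //; rewrite setTI.
  apply: subspace_continuous_measurable_fun => //.
  by apply: continuous_in_subspaceT => t /[!inE] /cj.
have mj : measurable_fun `[a, b] (EFin \o j).
  apply/measurable_EFinP; apply: subspace_continuous_measurable_fun => //.
  by apply: continuous_in_subspaceT => t /[!inE] /cj.
have w0 x : (0 <= w x)%R.
  by rewrite /w patchE; case: ifPn => // /[!inE] /j0/ltW.
pose m0 : {measure set (measurableTypeR R) -> \bar R} :=
  pushforward (density_measure mu mw w0) (psi : _ -> measurableTypeR R).
pose m1 := m0 mpsi.
have m1E x : m1 `]x, +oo[%classic =
    \int[mu]_(t in `[a, b] `&` psi @^-1` `]x, +oo[) (j t)%:E.
  rewrite /m1/m0/= /pushforward /density_measure [LHS]integral_mkcond.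
  rewrite [RHS]integral_mkcond; apply: eq_integral => t _.
  rewrite !patchE /w in_setI patchE.
  by case: (t \in `[a, b]%classic) => //; case: ifP.
have Dm : measurable (`[psi b, psi a]%classic : set (measurableTypeR R)) by [].
have psiD t : t \in `[a, b] -> psi t \in `[psi b, psi a].
  move=> tab; rewrite in_itv/=; apply/andP; split.
    have [->//|tb] := eqVneq t b; apply/ltW/decr => //.
    by rewrite lt_neqAle tb (itvP tab).
  have [->//|ta] := eqVneq t a; apply/ltW/decr => //.
  by rewrite lt_neqAle eq_sym ta (itvP tab).
(* Uniqueness of measures: the rays generate the Borel sets and are stable under intersection, and
   the rays from [-k] have finite mass and exhaust the line. *)
have m12 A : measurable A -> m1 A = mrestr mu Dm A.
  apply: (@measure_unique _ _ (measurableTypeR R) (@RGenOInfty.G R)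
    (fun k => `](- k%:R)%R, +oo[%classic)).
  - exact: RGenOInfty.measurableE.
  - move=> _ _ [x ->] [y ->]; exists (Num.max x y).
    rewrite predeqE => z /=; rewrite !in_itv/= !andbT gt_max.
    by split=> [[-> ->]//|/andP[]//].
  - by move=> k; exists (- k%:R)%R.
  - apply/seteqP; split => // x _; exists (Num.truncn (- x)).+1 => //=.
    by rewrite in_itv/= andbT ltrNl truncnS_gt.
  - move=> _ [x ->]; rewrite m1E.
    transitivity (mu (`]x, +oo[%classic `&` `[psi b, psi a]%classic)); last by [].
    (* Three positions of [x]: from [psi a] on, both masses are zero; below [psi b], both are the
       full mass [psi a - psi b]; in between, [x = psi z] and the preimage of the ray within
       [[a, b]] is [[a, z[]. *)
    have [ax|xa] := leP (psi a) x.
      rewrite (_ : _ `&` _ = set0) ?integral_set0; last first.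
        apply/seteqP; split => // t /= [tab]; rewrite in_itv/= andbT.
        by rewrite ltNge (le_trans _ ax)// (itvP (psiD _ tab)).
      rewrite (_ : _ `&` _ = set0) ?measure0//.
      apply/seteqP; split => // t /= [] /[!in_itv]/=; rewrite andbT => xt.
      by rewrite (leNgt t) (le_lt_trans ax xt) andbF.
    have [bx|xb] := leP (psi b) x; last first.
      rewrite setIidl; last first.
        move=> t /= tab; rewrite in_itv/= andbT (lt_le_trans xb)//.
        by rewrite (itvP (psiD _ tab)).
      rewrite (FTC _ _ aab bab (ltW ab)) setIidr; last first.
        by move=> t /=; rewrite !in_itv/= andbT => /andP[+ _]; exact: lt_le_trans.
      rewrite /= lebesgue_measure_itv/= lte_fin decr//.
    have [z zab zx] : exists2 z, z \in `[a, b] & psi z = x.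
      by apply: IVT => //; [exact: ltW|rewrite ge_min le_max bx (ltW xa) orbT].
    have az : (a < z)%R.
      rewrite lt_neqAle (itvP zab) andbT; apply/eqP => az.
      by rewrite az zx ltxx in xa.
    rewrite (_ : _ `&` _ = `[a, z[%classic); last first.
      apply/seteqP; split=> t /=; rewrite !in_itv/= andbT.
        move=> [/andP[at_ tb] xt]; rewrite at_/= ltNge; apply/negP => zt.
        move: zt; rewrite le_eqVlt => /predU1P[zt|zt].
          by rewrite -zt zx ltxx in xt.
        have /(lt_trans xt) : (psi t < psi z)%R.
          by apply: decr => //; rewrite in_itv/= at_.
        by rewrite zx ltxx.
      move=> /andP[at_ tz].
      have tb : (t <= b)%R by rewrite (le_trans (ltW tz))// (itvP zab).
      by rewrite at_ tb; split => //; rewrite -zx decr// in_itv/= at_.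
    rewrite integral_itv_bndo_bndc; last first.
      apply: measurable_funS mj => // t /=; rewrite !in_itv/= => /andP[->/= tz].
      by rewrite (le_trans (ltW tz))// (itvP zab).
    rewrite (FTC _ _ aab zab (ltW az)) zx.
    rewrite (_ : _ `&` _ = `]x, psi a]%classic); last first.
      apply/seteqP; split=> t /=; rewrite !in_itv/= andbT.
        by move=> [-> /andP[_ ->]].
      by move=> /andP[xt ->]; rewrite xt (le_trans bx (ltW xt)).
    by rewrite /= lebesgue_measure_itv/= lte_fin xa.
  - move=> k; rewrite m1E.
    apply: (@le_lt_trans _ _ (\int[mu]_(t in `[a, b]) (j t)%:E)).
      apply: ge0_subset_integral => //.
      + by apply: measurableI => //; exact: mpsiI.
      + by move=> t /j0 /ltW.
    by rewrite FTC ?ltry// ltW.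
(* On subsets of the image interval [mu] is [m1]; unfolding the push-forward and then the density
   yields the right-hand side. *)
rewrite (@eq_measure_integral _ _ _ _ m1); last first.
  by move=> A mA AD; rewrite m12// /mrestr; congr (mu _); apply/esym/setIidl.
rewrite ge0_integral_pushforward//=; last by move=> x /[!inE]; exact: g0.
have mpD : measurable (psi @^-1` `[psi b, psi a]).
  by exact: mpsiI.
rewrite integral_mkcond ge0_integral_density/=; last 2 first.
- apply/(measurable_restrictT _ _).1 => //.
  apply: measurable_comp mg _ => //; first exact: image_preimage_subset.
  exact: measurable_funTS.
- by move=> t; rewrite patchE; case: ifPn => // /[!inE]; exact: g0.
rewrite [RHS]integral_mkcond; apply: eq_integral => t _.
rewrite /w !patchE; have [tab|_] := boolP (t \in `[a, b]%classic);
  last by rewrite mule0.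
by rewrite mem_set//; move: tab => /[!inE]; exact: psiD.
Qed.

(** Working on open intervals allows [j] to blow up and [psi] not to be differentiable at the end
    points, as happens with powers. The open intervals are exhausted by compact ones, and monotone
    convergence passes to the limit on both sides. *)
Lemma ge0_decreasing_substitution psi j g (a b p q : R) : (a < b)%R ->
  measurable_fun setT psi ->
  {in `]a, b[, forall t : R, is_derive t (1%R : R) psi (- j t)%R} ->
  {in `]a, b[, continuous j} -> {in `]a, b[, forall t, (0 < j t)%R} ->
  {in `]a, b[, forall t, psi t \in `]p, q[} ->
  {in `]p, q[, forall x, exists2 t, t \in `]a, b[ & psi t = x} ->
  measurable_fun `]p, q[ g -> {in `]p, q[, forall x, 0 <= g x} ->
  \int[mu]_(x in `]p, q[) g x =
  \int[mu]_(t in `]a, b[) (g (psi t) * (j t)%:E).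
Proof.
move=> ab mpsi dpsi cj j0 psiD onto mg g0.
have cpsi : {in `]a, b[, continuous psi}.
  move=> t /dpsi dt; apply: differentiable_continuous.
  by apply/derivable1_diffP; case: dt.
have decr : {in `]a, b[ &, {homo psi : x y /~ (x < y)%R}}.
  apply: ltr0_derive1_lt_oo => t.
  - by move=> /dpsi[].
  - move=> tab; have dt := dpsi _ tab.
    by rewrite derive1E derive_val oppr_lt0 j0.
  - by move=> /[!inE]/cpsi.
have decr_le : {in `]a, b[ &, {homo psi : x y /~ (x <= y)%R}}.
  move=> x y xab yab; rewrite le_eqVlt => /predU1P[->//|yx].
  exact/ltW/decr.
(* A denominator of at least 3 keeps [2 * e n < b - a], so that every [F n] is a nondegenerate
   interval. *)
pose e n : R := ((b - a) / n.+3%:R)%R.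
have e0 n : (0 < e n)%R by rewrite divr_gt0 ?subr_gt0.
have e2 n : (e n * 2 < b - a)%R.
  rewrite mulrAC ltr_pdivrMr// ltr_pM2l ?subr_gt0// ltr_nat//.
have e_anti m n : (m <= n)%N -> (e n <= e m)%R.
  move=> mn; rewrite ler_pM2l ?subr_gt0// lef_pV2 ?posrE// ler_nat.
  by rewrite !ltnS.
have e_small (d : R) : (0 < d)%R -> exists n, (e n < d)%R.
  move=> d0; exists (Num.truncn ((b - a) / d)).
  rewrite ltr_pdivrMr// mulrC -ltr_pdivrMr//.
  by rewrite (lt_le_trans (truncnS_gt _))// ler_nat ltnS -addn2 leq_addr.
pose F n : set R := `[(a + e n)%R, (b - e n)%R]%classic.
(* As [psi] decreases, the image of [F n] has its end points exchanged. *)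
pose G n : set R := `[psi (b - e n)%R, psi (a + e n)%R]%classic.
have inab n : ((a + e n)%R \in `]a, b[) * ((b - e n)%R \in `]a, b[).
  by have := e0 n; have := e2 n; rewrite !in_itv/=; split; apply/andP; split; lra.
have Fab n : F n `<=` `]a, b[%classic.
  move=> t; rewrite /F/= !in_itv/= => /andP[t1 t2]; have := e0 n => en.
  by apply/andP; split; lra.
have Gpq n : G n `<=` `]p, q[%classic.
  move=> x; rewrite /G/= !in_itv/= => /andP[x1 x2].
  have [/psiD /[!in_itv]/= /andP[_ h1] /psiD /[!in_itv]/= /andP[h2 _]] := inab n.
  by rewrite (lt_le_trans h2 x1) (le_lt_trans x2 h1).
have UF : \bigcup_n F n = `]a, b[%classic.
  apply/seteqP; split=> [t [n _ /Fab//]|t /=]; rewrite in_itv/= => /andP[at_ tb].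
  have [|n en] := e_small (Num.min (t - a) (b - t))%R.
    by rewrite lt_min !subr_gt0 at_.
  exists n => //; rewrite /F/= in_itv/=; move: en; rewrite lt_min => /andP[t1 t2].
  by apply/andP; split; lra.
have UG : \bigcup_n G n = `]p, q[%classic.
  apply/seteqP; split=> [t [n _ /Gpq//]|x /= xpq].
  have [t tab <-] := onto _ xpq.
  have := tab; rewrite -[X in X -> _]/(`]a, b[%classic t) -UF => -[n _ Fnt].
  have [an bn] := inab n; exists n => //.
  by move: Fnt; rewrite /F/G/= !in_itv/= => /andP[t1 t2]; rewrite !decr_le.
have cvgG : \int[mu]_(x in G n) g x @[n --> \oo] --> \int[mu]_(x in `]p, q[) g x.
  rewrite -UG; apply: ge0_nondecreasing_set_cvg_integral => //.
  - move=> m n mn; rewrite subsetEset; apply: subset_itvScc; rewrite bnd_simp.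
      have := e_anti _ _ mn; have [] := inab m; have [] := inab n => *.
      by apply: decr_le => //; lra.
    have := e_anti _ _ mn; have [] := inab m; have [] := inab n => *.
    by apply: decr_le => //; lra.
  - by move=> n; exact: measurable_itv.
  - by move=> n; apply: measurable_funS mg => //; exact: Gpq.
  - by move=> n x /Gpq/g0.
have cvgF : \int[mu]_(t in F n) (g (psi t) * (j t)%:E) @[n --> \oo] -->
    \int[mu]_(t in `]a, b[) (g (psi t) * (j t)%:E).
  rewrite -UF; apply: ge0_nondecreasing_set_cvg_integral => //.
  - move=> m n mn; rewrite subsetEset; apply: subset_itvScc; rewrite bnd_simp;
    have := e_anti _ _ mn; lra.
  - by move=> n; exact: measurable_itv.
  - move=> n; apply: (measurable_funS (measurable_itv `]a, b[) (Fab n)).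
    apply: emeasurable_funM; last first.
      apply/measurable_EFinP; apply: open_continuous_measurable_fun.
        exact: interval_open.
      by move=> t /[!inE]/cj.
    apply: measurable_comp mg _ => //; last exact: measurable_funTS.
    by move=> _ [t /psiD + <-].
  - by move=> n t /Fab tab; rewrite mule_ge0// ?g0 ?psiD// lee_fin ltW// j0.
suff FG n :
    \int[mu]_(x in G n) g x = \int[mu]_(t in F n) (g (psi t) * (j t)%:E).
  move: cvgG; rewrite (funext FG) => cvgG.
  by apply: (cvg_unique _ cvgG cvgF).
apply: ge0_decreasing_substitution_cc => //.
- by have := e2 n; lra.
- by move=> t /Fab/dpsi.
- by move=> t /Fab/cj.
- by move=> t /Fab/j0.
- by apply: (measurable_funS (measurable_itv `]p, q[) (Gpq n)).
- by move=> t /Gpq/g0.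
Qed.
End decreasing_substitution.

(** * Transfer to the completed Lebesgue measure *)

Section completed_lebesgue.
Local Open Scope ereal_scope.
Context {R : realType}.
Notation mu := (@lebesgue_measure R).
Notation leb := (@completed_lebesgue_measure R).
Notation cR := (caratheodory_type (@wlength R idfun)^*%mu).

(** The completed sigma-algebra consists of the unions of a Borel set with a subset of a Borel null
    set. *)
Lemma completed_measurable_decomp (A : set R) :
  measurable (A : set cR) ->
  exists2 X : set R, measurable X & exists2 B : set R,
    measurable B /\ mu B = 0 & X `<=` A /\ A `<=` X `|` B.
Proof.
move=> mA.
have : (completed_algebra_gen mu).-sigma.-measurable A.
  by rewrite completed_caratheodory_measurable.
rewrite g_sigma_completed_algebra_genE => -[X mX [N [B [mB B0 NB]] <-]].
by exists X => //; exists B => //; split; [exact: subsetUl|exact: setUS].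
Qed.

Lemma measurable_completed (A : set R) : measurable A -> measurable (A : set cR).
Proof. exact: sub_caratheodory. Qed.

(* It suffices to discard a Borel null set for each of the countably many
   superlevel sets of [f] at a rational height. *)
Lemma completed_measurable_fun_borel (D : set R) (f : R -> \bar R) :
  measurable D -> measurable_fun (D : set cR) f ->
  exists2 B : set R, measurable B /\ mu B = 0 & measurable_fun (D `\` B) f.
Proof.
move=> mD mf.
(* An enumeration of the rationals. The default 0 for numbers that encode no rational is harmless:
   only the fact that every rational occurs is used. *)
pose q (n : nat) : R := ratr (odflt 0%R (unpickle n : option rat)).
have qP (x y : R) : (x < y)%R -> exists n, (x < q n < y)%R.
  move=> /rat_in_itvoo[r]; rewrite in_itv/= => xry.
  by exists (pickle r); rewrite /q pickleK.
pose S n := D `&` f @^-1` `](q n)%:E, +oo[.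
have /choice[X /choice[B XB]] : forall n, exists X, exists B : set R,
    [/\ measurable X, measurable B, mu B = 0, X `<=` S n & S n `<=` X `|` B].
  move=> n; have [|X mX [B [mB B0] [XS SXB]]] := @completed_measurable_decomp (S n).
    by apply: mf; [exact: measurable_completed|exact: emeasurable_itv].
  by exists X, B.
have mX n : measurable (X n) by case: (XB n).
have mB : measurable (\bigcup_n B n).
  by apply: bigcupT_measurable => n; case: (XB n).
exists (\bigcup_n B n).
  split => //; apply: measure_negligible => //; apply: negligible_bigcup => n.
  by have [_ ? ? _ _] := XB n; exact/negligibleP.
move=> mDB; apply: (measurability _ (ErealGenOInfty.measurableE R)) => //.
move=> _ [_ [x ->] <-].
(* A value [f t] exceeds [x] exactly when some [q n] lies strictly between them, and off the union
   of the [B n] the sets [S n] and [X n] coincide. *)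
rewrite (_ : _ `&` _ =
  \bigcup_(n in [set n | x < q n]%R) (X n `\` \bigcup_n B n)).
  by apply: bigcup_measurable => n _; exact: measurableD.
apply/seteqP; split=> [t [[Dt Bt]]|t [n /= xn [Xt Bt]]].
  rewrite /= in_itv/= andbT => xft.
  have [n /andP[xn nt]] : exists n, x%:E < (q n)%:E < f t.
    case: (f t) xft => [y|_|//].
      by rewrite lte_fin => /qP[n ?]; exists n; rewrite !lte_fin.
    by have [n /andP[? _]] := qP x (x + 1)%R (ltr_pwDr ltr01 (lexx _));
      exists n; rewrite lte_fin ltry andbT.
  exists n; rewrite /= -?lte_fin//; split => //.
  have [_ _ _ _ /(_ t)[]//] := XB n; first by split => //=; rewrite in_itv/= nt.
  by move=> Bn; case: Bt; exists n.
have [_ _ _ /(_ t Xt)[Dt + ] _] := XB n; rewrite /= in_itv/= andbT => nt.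
by split => //=; rewrite in_itv/= andbT (lt_trans _ nt)// lte_fin.
Qed.

(** Lebesgue measure on Borel sets is the push-forward of the completed measure by the identity
    map. *)
Lemma ge0_completed_integralE (D : set R) (f : R -> \bar R) :
  measurable D -> measurable_fun D f -> {in D, forall x, 0 <= f x} ->
  \int[leb]_(x in D) f x = \int[mu]_(x in D) f x.
Proof.
move=> mD mf f0.
have mid : measurable_fun [set: cR] (idfun : cR -> measurableTypeR R).
  by move=> _ A mA; rewrite setTI; exact: measurable_completed.
rewrite -(ge0_integral_pushforward mid leb mD mf f0).
exact: eq_measure_integral.
Qed.

Lemma completed_integralE (D : set R) (f : R -> \bar R) :
  measurable D -> measurable_fun D f ->
  \int[leb]_(x in D) f x = \int[mu]_(x in D) f x.
Proof.
move=> mD mf; rewrite integralE [RHS]integralE !ge0_completed_integralE//.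
- exact: measurable_funeneg.
- exact: measurable_funepos.
Qed.

Lemma completed_integrableE (D : set R) (f : R -> \bar R) :
  measurable D -> measurable_fun D f ->
  mu.-integrable D f <-> leb.-integrable D f.
Proof.
move=> mD mf; split => /integrableP[_ fi]; apply/integrableP; split => //.
- by move=> _ A mA; apply: measurable_completed; exact: mf.
- rewrite ge0_completed_integralE//; exact: measurableT_comp.
- rewrite -ge0_completed_integralE//; exact: measurableT_comp.
Qed.
End completed_lebesgue.

(** * Decreasing substitutions for the completed measure *)

Section completed_decreasing_substitution.
Local Open Scope ereal_scope.
Context {R : realType}.
Notation mu := (@lebesgue_measure R).
Notation leb := (@completed_lebesgue_measure R).
Notation cR := (caratheodory_type (@wlength R idfun)^*%mu).
Variables (psi j : R -> R) (a b p q : R).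
Hypothesis ab : (a < b)%R.
Hypothesis mpsi : measurable_fun setT psi.
Hypothesis dpsi : {in `]a, b[, forall t : R, is_derive t (1%R : R) psi (- j t)%R}.
Hypothesis cj : {in `]a, b[, continuous j}.
Hypothesis j0 : {in `]a, b[, forall t, (0 < j t)%R}.
Hypothesis psiD : {in `]a, b[, forall t, psi t \in `]p, q[}.
Hypothesis onto : {in `]p, q[, forall x, exists2 t, t \in `]a, b[ & psi t = x}.

Let sub g :=
  @ge0_decreasing_substitution R psi j g a b p q ab mpsi dpsi cj j0 psiD onto.

Let measurable_sub g : measurable_fun `]p, q[ g ->
  measurable_fun `]a, b[ (fun t => g (psi t) * (j t)%:E).
Proof.
move=> mg; apply: emeasurable_funM; last first.
  apply/measurable_EFinP; apply: open_continuous_measurable_fun.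
    exact: interval_open.
  by move=> t /[!inE]/cj.
apply: measurable_comp mg _ => //; last exact: measurable_funTS.
by move=> _ [t /psiD + <-].
Qed.

Let integrable_sub g : mu.-integrable `]p, q[ g ->
  mu.-integrable `]a, b[ (fun t => g (psi t) * (j t)%:E).
Proof.
move=> /integrableP[mg gi]; apply/integrableP; split; first exact: measurable_sub.
rewrite sub// in gi; last exact: measurableT_comp.
apply: le_lt_trans gi; rewrite le_eqVlt; apply/orP; left; apply/eqP.
apply: eq_integral => t /[!inE]/= tab.
by rewrite abseM [X in _ * X]gee0_abs// lee_fin ltW// j0.
Qed.

Let integral_sub g : measurable_fun `]p, q[ g ->
  \int[mu]_(x in `]p, q[) g x = \int[mu]_(t in `]a, b[) (g (psi t) * (j t)%:E).
Proof.
move=> mg; rewrite integralE [RHS]integralE.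
rewrite sub//; last exact: measurable_funepos.
rewrite sub//; last exact: measurable_funeneg.
congr (_ - _); apply: eq_integral => t /[!inE]/= /j0 jt.
  by rewrite !funeposE maxe_pMl ?mul0e ?lee_fin ?ltW.
by rewrite !funenegE -mulNe maxe_pMl ?mul0e ?lee_fin ?ltW.
Qed.

(** Substituting in the integral of the indicator of [B], which is zero, shows that the indicator of
    the preimage times [j] has integral zero; as [j] is positive, the preimage is null. *)
Let null_sub (B : set R) : measurable B -> mu B = 0 ->
  mu (`]a, b[ `&` psi @^-1` B) = 0.
Proof.
move=> mB B0.
have mpB : measurable (psi @^-1` B).
  by rewrite -[X in measurable X]setTI; exact: mpsi.
have : \int[mu]_(x in `]p, q[) (\1_B x)%:E = 0.
  rewrite integral_indic//; apply/eqP; rewrite eq_le measure_ge0 andbT -B0.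
  by rewrite le_measure// inE//; exact: measurableI.
have mI : measurable_fun `]p, q[ (fun x => (\1_B x)%:E : \bar R).
  exact/measurable_EFinP.
rewrite sub// => I0.
apply: measure_negligible; first exact: measurableI.
have [h _] := @ae_eq_integral_abs _ _ _ mu _ (measurable_itv `]a, b[) _
  (measurable_sub mI).
have [|N [mN N0 NP]] := h _.
  rewrite -[RHS]I0; apply: eq_integral => t /[!inE]/= tab.
  by rewrite ger0_norm// mulr_ge0// ltW// j0.
exists N; split => // t [/= tab Bt]; apply: NP => /= /(_ tab).
rewrite indicE mem_set// mul1e => -[] jt.
by have := j0 tab; rewrite jt ltxx.
Qed.

(** Off a Borel null set [B], [g] agrees with a Borel function [g1], to which the Borel substitution
    applies. By [null_sub] the integrands obtained from [g] and [g1] still agree almost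
    everywhere. *)
Lemma completed_decreasing_substitution (g : R -> \bar R) :
  leb.-integrable `]p, q[ g ->
  leb.-integrable `]a, b[ (fun t => g (psi t) * (j t)%:E) /\
  \int[leb]_(x in `]p, q[) g x = \int[leb]_(t in `]a, b[) (g (psi t) * (j t)%:E).
Proof.
move=> /integrableP[mg gi].
have [//|B [mB B0] mgB] := completed_measurable_fun_borel _ mg.
pose g1 := g \_ (`]p, q[ `\` B).
have mpqB : measurable (`]p, q[%classic `\` B) by exact: measurableD.
have mg1 : measurable_fun `]p, q[ g1.
  by apply: measurable_funTS; apply/(measurable_restrictT _ _).1.
have cmg1 : measurable_fun (`]p, q[%classic : set cR) g1.
  by move=> _ A mA; apply: measurable_completed; exact: mg1.
have gg1 : @ae_eq _ cR R leb (fun=> \bar R) `]p, q[%classic g g1.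
  exists B; split => //; first exact: measurable_completed.
  move=> x /= /not_implyP[xpq xB]; apply: contrapT => nBx; apply: xB.
  by rewrite /g1 patchE mem_set.
have cmpq : measurable (`]p, q[%classic : set cR) by exact: measurable_completed.
have cmab : measurable (`]a, b[%classic : set cR) by exact: measurable_completed.
have g1i : mu.-integrable `]p, q[ g1.
  apply/completed_integrableE => //; apply/integrableP; split => //.
  rewrite -(ae_eq_integral _ _ _ _ _ (ae_eq_abse gg1))//; exact: measurableT_comp.
have g1j := integrable_sub g1i.
have mg1j := measurable_sub mg1.
have g1jE : @ae_eq _ cR R leb (fun=> \bar R) `]a, b[%classic
    (fun t => g1 (psi t) * (j t)%:E) (fun t => g (psi t) * (j t)%:E).
  exists (`]a, b[ `&` psi @^-1` B); split.
  - apply: measurable_completed; apply: measurableI => //.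
    by rewrite -[X in measurable X]setTI; exact: mpsi.
  - exact: null_sub.
  - move=> t /= /not_implyP[tab tB]; split => //=.
    apply: contrapT => nBt; apply: tB.
    rewrite /g1 patchE mem_set//; split => //; exact: psiD.
have cmgj : measurable_fun (`]a, b[%classic : set cR)
    (fun t => g (psi t) * (j t)%:E).
  (* Here completeness is essential: [g] composed with [psi] is only known to agree almost
     everywhere with a measurable function. *)
  apply: (ae_measurable_fun completed_lebesgue_measure_is_complete g1jE).
  by move=> _ A mA; apply: measurable_completed; exact: mg1j.
have cmg1j : measurable_fun (`]a, b[%classic : set cR)
    (fun t => g1 (psi t) * (j t)%:E).
  by move=> _ A mA; apply: measurable_completed; exact: mg1j.
split; last first.
  rewrite (ae_eq_integral _ _ _ _ _ gg1)// [LHS]completed_integralE// integral_sub//.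
  by rewrite -completed_integralE//; exact: ae_eq_integral.
apply/integrableP; split => //.
move/completed_integrableE : g1j => /(_ _ _)/integrableP[]// _.
rewrite -(ae_eq_integral _ _ _ _ _ (ae_eq_abse g1jE))//; exact: measurableT_comp.
Qed.

End completed_decreasing_substitution.

(** * Power substitutions *)

Section powR_facts.
Context {R : realType}.
Implicit Types (x y r : R).

Lemma powRK r x : r != 0 -> 0 <= x -> (x `^ r) `^ r^-1 = x.
Proof. by move=> r0 x0; rewrite -powRrM mulfV// powRr1. Qed.

Lemma powRVK r x : r != 0 -> 0 <= x -> (x `^ r^-1) `^ r = x.
Proof. by move=> r0 x0; rewrite -powRrM mulVf// powRr1. Qed.

Lemma ltr_powR2r r x y : 0 < r -> 0 <= x -> 0 <= y -> (x `^ r < y `^ r) = (x < y).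
Proof.
move=> r0 x0 y0; apply/idP/idP; last by apply: gt0_ltr_powR.
by rewrite !ltNge; apply: contra => yx; apply: ge0_ler_powR => //; exact: ltW.
Qed.

Lemma powR_continuous r x : 0 < x -> {for x, continuous (@powR R ^~ r)}.
Proof.
move=> x0; apply: differentiable_continuous; apply/derivable1_diffP.
by have [] := @is_derive1_powR R r x x0.
Qed.

End powR_facts.

Section power_substitution.
Context {R : realType}.
Variables (C rho beta a b : R).
Hypotheses (rho0 : 0 < rho) (beta0 : 0 < beta) (a0 : 0 <= a) (ab : a < b).
Hypothesis bC : b `^ rho <= C.

(** Two instances matter: [C = 1] with [beta = rho^-1] exchanges the two fractional integrals, and
    [C = b^rho] with [beta = alpha] is, up to a constant factor, an antiderivative of the weight. *)
Definition subst_powR (t : R) : R := (C - t `^ rho) `^ beta.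

Definition subst_powR_jac (t : R) : R :=
  beta * rho * (t `^ (rho - 1) * (C - t `^ rho) `^ (beta - 1)).

Let ab_gt0 t : t \in `]a, b[ -> 0 < t.
Proof. by rewrite in_itv/= => /andP[/(le_lt_trans a0)]. Qed.

Let ab_lt t : t \in `]a, b[ -> a `^ rho < t `^ rho < b `^ rho.
Proof.
move=> tab; have t0 := ab_gt0 tab; move: tab; rewrite in_itv/= => /andP[at_ tb].
by rewrite !ltr_powR2r ?at_// ltW// (lt_trans _ tb).
Qed.

Let C_gt0 t : t \in `]a, b[ -> 0 < C - t `^ rho.
Proof. by move=> /ab_lt/andP[_ tb]; rewrite subr_gt0 (lt_le_trans tb). Qed.

Lemma measurable_subst_powR : measurable_fun setT subst_powR.
Proof.
apply: (measurableT_comp (measurable_powR _)).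
by apply: measurable_funB => //; exact: measurable_powR.
Qed.

Lemma is_derive_subst_powR : {in `]a, b[, forall t : R,
  is_derive t (1 : R) subst_powR (- subst_powR_jac t)}.
Proof.
move=> t tab; have t0 := ab_gt0 tab; have Ct0 := C_gt0 tab.
have dt := @is_derive1_powR R rho t t0.
have dC := @is_derive1_powR R beta _ Ct0.
have dB : is_derive t (1 : R) (fun u => C - u `^ rho) (- (rho * t `^ (rho - 1))).
  by rewrite -sub0r; exact: is_deriveB.
have := @is_derive1_comp _ (@powR R ^~ beta) (fun u => C - u `^ rho) t _ _ dC dB.
move=> H; apply: (is_derive_eq H); rewrite /subst_powR_jac; ring.
Qed.

Lemma continuous_subst_powR_jac : {in `]a, b[, continuous subst_powR_jac}.
Proof.
move=> t tab; have t0 := ab_gt0 tab; have Ct0 := C_gt0 tab.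
apply: cvgM; first exact: cvg_cst.
apply: cvgM; first exact: powR_continuous.
apply: (@continuous_comp _ _ _ (fun u => C - u `^ rho) (@powR R ^~ (beta - 1))).
  by apply: cvgB; [exact: cvg_cst|exact: powR_continuous].
exact: powR_continuous.
Qed.

Lemma subst_powR_jac_gt0 : {in `]a, b[, forall t, 0 < subst_powR_jac t}.
Proof.
move=> t tab; have t0 := ab_gt0 tab; have Ct0 := C_gt0 tab.
by rewrite !mulr_gt0// powR_gt0.
Qed.

Let p := (C - b `^ rho) `^ beta.
Let q := (C - a `^ rho) `^ beta.

Lemma subst_powR_itv : {in `]a, b[, forall t, subst_powR t \in `]p, q[}.
Proof.
move=> t tab; have /andP[t1 t2] := ab_lt tab; have := C_gt0 tab => Ct0.
have := bC => bC'; rewrite in_itv/= /p /q /subst_powR.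
by apply/andP; split; rewrite ltr_powR2r//; lra.
Qed.

(** The preimage of [x] is (C - x^(1/beta))^(1/rho); its position between [a] and [b] is checked
    after raising to the power [rho]. *)
Lemma subst_powR_onto :
  {in `]p, q[, forall x, exists2 t, t \in `]a, b[ & subst_powR t = x}.
Proof.
move=> x; rewrite in_itv/= => /andP[px xq].
have x0 : 0 <= x by apply: le_trans (ltW px); exact: powR_ge0.
have b0 : 0 <= b by exact: le_trans (ltW ab).
have aC : a `^ rho <= C.
  by apply: le_trans bC; apply: ge0_ler_powR => //; exact: ltW.
have y0 : 0 <= x `^ beta^-1 by exact: powR_ge0.
have yx : (x `^ beta^-1) `^ beta = x by rewrite powRVK// gt_eqF.
set y := x `^ beta^-1 in y0 yx *.
have Cb0 : 0 <= C - b `^ rho by rewrite subr_ge0.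
have Ca0 : 0 <= C - a `^ rho by rewrite subr_ge0.
move: px xq; rewrite /p /q -yx !ltr_powR2r// => h1 h2.
have ar0 := powR_ge0 a rho.
have Cy0 : 0 <= C - y by lra.
have [t t0 tr] : exists2 t, 0 <= t & t `^ rho = C - y.
  by exists ((C - y) `^ rho^-1); [exact: powR_ge0|rewrite powRVK// gt_eqF].
exists t; last by rewrite /subst_powR tr subKr.
rewrite in_itv/= -(@ltr_powR2r R rho a t rho0 a0 t0).
rewrite -(@ltr_powR2r R rho t b rho0 t0 b0).
by rewrite tr ltrBrDl -ltrBrDr h2 ltrBlDl -ltrBlDr h1.
Qed.

End power_substitution.

Lemma completed_powR_substitution (R : realType) (C rho beta a b : R)
    (g : R -> \bar R) : 0 < rho -> 0 < beta -> 0 <= a -> a < b -> b `^ rho <= C ->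
  let p := (C - b `^ rho) `^ beta in let q := (C - a `^ rho) `^ beta in
  let g' t := (g (subst_powR C rho beta t) * (subst_powR_jac C rho beta t)%:E)%E in
  (@completed_lebesgue_measure R).-integrable `]p, q[ g ->
  (@completed_lebesgue_measure R).-integrable `]a, b[ g' /\
  (\int[@completed_lebesgue_measure R]_(x in `]p, q[) g x =
   \int[@completed_lebesgue_measure R]_(t in `]a, b[) g' t)%E.
Proof.
move=> rho0 beta0 a0 ab bC p q g' gi.
apply: completed_decreasing_substitution gi => //.
- exact: measurable_subst_powR.
- exact: is_derive_subst_powR.
- exact: continuous_subst_powR_jac.
- exact: subst_powR_jac_gt0.
- exact: subst_powR_itv.
- exact: subst_powR_onto.
Qed.

(** * Total mass of the weight *)

Section katugampola_weight.
Context {R : realType}.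
Notation mu := (@lebesgue_measure R).
Variables (rho alpha a b : R).
Hypotheses (rho0 : 0 < rho) (alpha0 : 0 < alpha) (a0 : 0 <= a) (ab : a < b).

(** With [C = b^rho] and [beta = alpha] the Jacobian is [alpha * rho] times the weight. Substituting
    in the constant function 1 therefore gives the length of the image interval, whose lower end is
    0^alpha = 0. *)
Lemma integral_katugampola_weight : (\int[mu]_(t in `]a, b[)
    (t `^ (rho - 1) * (b `^ rho - t `^ rho) `^ (alpha - 1))%R%:E =
  ((b `^ rho - a `^ rho) `^ alpha / (alpha * rho))%R%:E)%E.
Proof.
have bb := lexx (b `^ rho).
have ab' : a `^ rho < b `^ rho by rewrite ltr_powR2r// (le_trans a0)// ltW.
pose j := subst_powR_jac (b `^ rho) rho alpha.
have : (\int[mu]_(x in `]((b `^ rho - b `^ rho) `^ alpha)%R,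
                         ((b `^ rho - a `^ rho) `^ alpha)%R[) 1 =
  \int[mu]_(t in `]a, b[) (1 * (j t)%:E))%E.
  apply: (ge0_decreasing_substitution ab
    (measurable_subst_powR (b `^ rho) rho alpha)).
  - exact: is_derive_subst_powR.
  - exact: continuous_subst_powR_jac.
  - exact: subst_powR_jac_gt0.
  - exact: subst_powR_itv.
  - exact: subst_powR_onto.
  - exact: measurable_cst.
  - by move=> x _.
rewrite subrr powR0 ?gt_eqF// integral_cst//= mul1e lebesgue_measure_itv/=.
rewrite lte_fin powR_gt0 ?subr_gt0// oppr0 adde0.
under eq_integral do rewrite mul1e /j /subst_powR_jac EFinM.
rewrite ge0_integralZl//; last 3 first.
- apply/measurable_EFinP; apply: measurable_funM.
    by apply: measurable_funTS; exact: measurable_powR.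
  apply: measurable_funTS; apply: (measurableT_comp (measurable_powR _)).
  by apply: measurable_funB => //; exact: measurable_powR.
- by move=> t _; rewrite lee_fin mulr_ge0// powR_ge0.
- by rewrite lee_fin mulr_ge0// ltW.
set V := (_ `^ alpha); set I := integral _ _ _ => H.
have ar0 : alpha * rho != 0 by rewrite gt_eqF ?mulr_gt0.
have -> : ((V / (alpha * rho))%:E = (alpha * rho)^-1%:E * V%:E)%E.
  by rewrite -EFinM [in LHS]mulrC.
by rewrite H muleA -EFinM mulVf// mul1e.
Qed.

End katugampola_weight.

(** * Functional equation of the Gamma function *)

Section gamma.
Local Open Scope ereal_scope.
Context {R : realType}.
Notation mu := (@lebesgue_measure R).
Implicit Types (z alpha u : R).

(** The integral is kept in the extended reals, so that Tonelli's theorem yields the functional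
    equation before finiteness is known. *)
Let egamma z : \bar R :=
  \int[mu]_(t in `]0%R, +oo[) (t `^ (z - 1) * expR (- t))%:E.

Let measurable_gamma_fun z (D : set R) :
  measurable_fun D (fun t : R => (t `^ (z - 1) * expR (- t))%:E).
Proof.
apply/measurable_EFinP; apply: measurable_funM.
  by apply: measurable_funTS; exact: measurable_powR.
by apply: measurable_funTS; apply: measurableT_comp => //; exact: measurable_expR.
Qed.

Lemma integral_expRN u :
  \int[mu]_(t in `]u, +oo[) (expR (- t))%:E = (expR (- u))%:E.
Proof.
rewrite integral_itv_obnd_cbnd; last first.
  apply/measurable_EFinP; apply: measurable_funTS.
  by apply: measurableT_comp => //; exact: measurable_expR.
have cN : continuous (fun t : R => expR (- t))%R.
  move=> t; apply: (@continuous_comp _ _ _ (-%R) expR); first exact: opp_continuous.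
  exact: continuous_expR.
have dN (t : R) : is_derive t (1%R : R) (fun t : R => - expR (- t))%R (expR (- t)).
  by apply: is_derive_eq; rewrite mulrN1 opprK.
rewrite (@ge0_continuous_FTC2y _ _ (fun t => - expR (- t))%R _ 0%R).
- by rewrite EFinN oppeK add0e.
- by move=> t _; exact: expR_ge0.
- exact: continuous_subspaceT.
- by rewrite -oppr0; apply: cvgN; exact: cvgr_expR.
- by move=> t _; have [] := dN t.
- by apply: cvg_at_right_filter; apply: cvgN; exact: cN.
- by move=> t _; rewrite derive1E; apply: derive_val.
Qed.

(** This is the mass of the weight with [alpha] in the role of [rho] and 1 in the role of [alpha]:
    the second factor becomes a zeroth power, that is 1. *)
Lemma integral_powR_itv0 alpha u : (0 < alpha)%R -> (0 < u)%R ->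
  \int[mu]_(t in `]0%R, u[) (t `^ (alpha - 1))%R%:E = (u `^ alpha / alpha)%R%:E.
Proof.
move=> alpha0 u0.
have := @integral_katugampola_weight R alpha 1 0 u alpha0 ltr01 (lexx _) u0.
rewrite subrr mul1r powR0 ?gt_eqF// subr0 powRr1 ?powR_ge0// => <-.
by apply: eq_integral => t _; rewrite powRr0 mulr1.
Qed.

(* Tonelli's theorem for [u `^ (alpha - 1) * expR (- t)] on [0 < u < t]. *)
Let egammaS alpha : (0 < alpha)%R -> egamma (alpha + 1) = alpha%:E * egamma alpha.
Proof.
move=> alpha0.
(* The first coordinate of [z] is [t], the second is [u]. *)
pose f (z : R * R) : \bar R :=
  (if (0 < z.2) && (z.2 < z.1) then z.2 `^ (alpha - 1) * expR (- z.1) else 0)%R%:E.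
have mf : measurable_fun setT f.
  apply/measurable_EFinP; apply: measurable_fun_ifT => //.
    apply: measurable_and; first exact: measurable_fun_ltr.
    exact: measurable_fun_ltr.
  apply: measurable_funM.
    exact: (measurableT_comp (measurable_powR _)).
  apply: measurableT_comp; first exact: measurable_expR.
  by apply: measurableT_comp => //; exact: measurable_fst.
have f0 (z : R * R) : 0 <= f z.
  by rewrite lee_fin; case: ifP => // _; rewrite mulr_ge0 ?powR_ge0 ?expR_ge0.
have := @fubini_tonelli _ _ _ _ R mu mu f mf f0.
(* For fixed [t], integrating over [u] in []0, t[] gives t^alpha / alpha times exp(-t). *)
have -> : \int[mu]_x \int[mu]_y f (x, y) = alpha^-1%:E * egamma (alpha + 1).
  rewrite -ge0_integralZl//; last 3 first.
  - exact: measurable_gamma_fun.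
  - by move=> t _; rewrite lee_fin mulr_ge0 ?powR_ge0 ?expR_ge0.
  - by rewrite lee_fin invr_ge0 ltW.
  rewrite [RHS]integral_mkcond; apply: eq_integral => t _.
  rewrite patchE mem_setE in_itv/= andbT; case: ifPn => t0; last first.
    apply: integral0_eq => u _; rewrite /f/=; case: ifP => // /andP[u0 ut].
    by rewrite (lt_trans u0 ut) in t0.
  rewrite addrK -EFinM mulrA (mulrC alpha^-1%R) EFinM muleC.
  rewrite -integral_powR_itv0// -ge0_integralZl//; last 2 first.
  - by apply/measurable_EFinP; apply: measurable_funTS; exact: measurable_powR.
  - by move=> u _; rewrite lee_fin powR_ge0.
  rewrite [RHS]integral_mkcond; apply: eq_integral => u _.
  rewrite patchE /f/= -EFinM mulrC.
  by rewrite mem_setE in_itv/=; case: ifP.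
(* For fixed [u], integrating over [t > u] gives u^(alpha - 1) exp(-u). *)
have -> : \int[mu]_y \int[mu]_x f (x, y) = egamma alpha.
  rewrite /egamma [RHS]integral_mkcond; apply: eq_integral => u _.
  rewrite patchE mem_setE in_itv/= andbT; case: ifPn => u0; last first.
    by apply: integral0_eq => t _; rewrite /f/= (negbTE u0).
  rewrite EFinM -integral_expRN -ge0_integralZl//; last 2 first.
  - apply/measurable_EFinP; apply: measurable_funTS.
    by apply: measurableT_comp => //; exact: measurable_expR.
  - by rewrite lee_fin powR_ge0.
  rewrite [RHS]integral_mkcond; apply: eq_integral => t _.
  by rewrite patchE /f/= u0 /= -EFinM mem_setE in_itv/= andbT; case: ifP.
move=> <-.
by rewrite muleA -EFinM mulfV ?mul1e// gt_eqF.
Qed.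

Let gamma_fun_ge0 z (t : R) : 0 <= (t `^ (z - 1) * expR (- t))%:E.
Proof. by rewrite lee_fin mulr_ge0 ?powR_ge0 ?expR_ge0. Qed.

(** Below 1 the exponential is at most 1 and the power is integrable; above 1 the power is at most
    1, because [alpha <= 1], and the exponential is integrable. *)
Let egamma_lty1 alpha : (0 < alpha)%R -> (alpha <= 1)%R -> egamma alpha < +oo.
Proof.
move=> alpha0 alpha1.
have itvU :
    `]0%R, +oo[%classic = `]0%R, 1%R[%classic `|` `[1%R, +oo[%classic :> set R.
  apply/seteqP; split => t /=; rewrite !in_itv/= !andbT.
    by move=> ->; case: (ltP t 1%R); [left|right].
  by move=> [/andP[]//|]; exact: lt_le_trans.
rewrite /egamma itvU ge0_integral_setU//; last 2 first.
- exact: measurable_gamma_fun.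
- apply/disj_setPS => t /= []; rewrite !in_itv/= andbT => /andP[_ t1].
  by rewrite leNgt t1.
apply: lte_add_pinfty.
  apply: (@le_lt_trans _ _ (\int[mu]_(t in `]0%R, 1%R[) (t `^ (alpha - 1))%:E)).
    apply: ge0_le_integral => //.
    - exact: measurable_gamma_fun.
    - by apply/measurable_EFinP; apply: measurable_funTS; exact: measurable_powR.
    - move=> t /=; rewrite in_itv/= => /andP[t0 _]; rewrite lee_fin.
      by rewrite ler_piMr ?powR_ge0// -expR0 ler_expR oppr_le0 ltW.
  by rewrite integral_powR_itv0// ltry.
apply: (@le_lt_trans _ _ (\int[mu]_(t in `[1%R, +oo[) (expR (- t))%:E)).
  apply: ge0_le_integral => //.
  - exact: measurable_gamma_fun.
  - apply/measurable_EFinP; apply: measurable_funTS.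
    by apply: measurableT_comp => //; exact: measurable_expR.
  - move=> t /=; rewrite in_itv/= andbT => t1; rewrite lee_fin.
    rewrite ler_piMl ?expR_ge0//; apply: (@le_trans _ _ (t `^ 0)%R).
      by apply: ler_powR => //; rewrite subr_le0.
    by rewrite powRr0.
rewrite -integral_itv_obnd_cbnd; last first.
  apply/measurable_EFinP; apply: measurable_funTS.
  by apply: measurableT_comp => //; exact: measurable_expR.
by rewrite integral_expRN ltry.
Qed.

(** Induction on an integer [n] with [alpha <= n + 1], the functional equation lowering [alpha] by
    one. *)
Let egamma_lty alpha : (0 < alpha)%R -> egamma alpha < +oo.
Proof.
move=> alpha0.
have : (alpha <= (Num.truncn alpha).+1%:R)%R by apply/ltW/truncnS_gt.
move: (Num.truncn alpha) => n; elim: n alpha alpha0 => [|n ih] alpha alpha0.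
  exact: egamma_lty1.
have [a1 _|a1] := leP alpha 1%R; first exact: egamma_lty1.
rewrite -natr1 -lerBlDr => an.
have a10 : (0 < alpha - 1)%R by rewrite subr_gt0.
rewrite -(subrK 1%R alpha) egammaS// lte_mul_pinfty// ?lee_fin ?ltW//.
exact: ih.
Qed.

Let egamma_gt0 alpha : (0 < alpha)%R -> 0 < egamma alpha.
Proof.
move=> alpha0.
(* On []1, 2[] the power is at least 1/t, hence at least 1/2, and the exponential is at least
   exp(-2). *)
apply: (@lt_le_trans _ _ (\int[mu]_(t in `]1%R, 2%R[) (2^-1 * expR (- 2))%:E)).
  rewrite integral_cst//= lebesgue_measure_itv/= lte_fin ltr1n -EFinB -EFinM.
  by rewrite lte_fin !mulr_gt0 ?expR_gt0// subr_gt0 ltr1n.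
apply: (@le_trans _ _
  (\int[mu]_(t in `]1%R, 2%R[) (t `^ (alpha - 1) * expR (- t))%:E)).
  apply: ge0_le_integral => //.
  - exact: measurable_gamma_fun.
  - move=> t /=; rewrite in_itv/= => /andP[t1 t2]; rewrite lee_fin.
    have t0 : (0 < t)%R by exact: lt_trans t1.
    apply: ler_pM => //.
      apply: (@le_trans _ _ (t `^ (-1))%R).
        by rewrite powR_inv1 ?ltW// ltf_pV2// posrE.
      by apply: ler_powR; [exact: ltW|lra].
    by rewrite ler_expR lerN2 ltW.
apply: ge0_subset_integral => //; first exact: measurable_gamma_fun.
by move=> t /=; rewrite !in_itv/= andbT => /andP[/(lt_trans ltr01)].
Qed.

Let GammaE alpha : Gamma alpha = fine (egamma alpha).
Proof. by []. Qed.

Lemma Gamma_gt0 alpha : (0 < alpha)%R -> (0 < Gamma alpha)%R.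
Proof. by move=> a0; rewrite GammaE fine_gt0// egamma_gt0//= egamma_lty. Qed.

Lemma GammaD1 alpha : (0 < alpha)%R -> (Gamma (alpha + 1) = alpha * Gamma alpha)%R.
Proof.
move=> a0; rewrite !GammaE egammaS// fineM//.
by rewrite ge0_fin_numE ?egamma_lty// ltW// egamma_gt0.
Qed.

End gamma.

(** * Katugampola integrals of h-convex functions *)

Section geodesic_hconvexity.
Context {R : realType} {M : metricType R}.
Variables (K : set M) (h : R -> R) (f : M -> R) (gamma : R -> M).
Hypotheses (hf : geodesically_hconvex h K f) (hgamma : geodesic gamma)
  (hgammaK : curve_in K gamma).

(** The affine map [sub] fixes 1/2 and sends 0 and 1 to [x] and [1 - x], so [gamma \o sub] is a
    geodesic in [K] between the points wanted, and h-convexity is applied to it at its midpoint. *)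
Lemma hconvex_midpoint x : x \in `[0, 1] ->
  f (gamma 2^-1) <= h 2^-1 * (f (gamma x) + f (gamma (1 - x))).
Proof.
move=> x01; pose sub t : R := (1 - t) * x + t * (1 - x).
have sub01 t : t \in `[0, 1] -> sub t \in `[0, 1].
  move: x01; rewrite !in_itv/= /sub => /andP[x0 x1] /andP[t0 t1].
  by apply/andP; split; nra.
have z01 : (0 : R) \in `[0, 1] by rewrite in_itv/= lexx ler01.
have o01 : (1 : R) \in `[0, 1] by rewrite in_itv/= lexx ler01.
have half01 : (2^-1 : R) \in `[0, 1] by rewrite in_itv/=; apply/andP; split; lra.
have geo : geodesic (gamma \o sub).
  move=> s t s01 t01 /=; rewrite (hgamma (sub01 _ s01) (sub01 _ t01)).
  rewrite (hgamma (sub01 _ z01) (sub01 _ o01)) mulrA -normrM.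
  (* Since sub s - sub t = (s - t)(1 - 2x), whereas sub 0 - sub 1 = -(1 - 2x), one sign has to be
     reversed inside the absolute value. *)
  by rewrite -normrN; congr (`|_| * _); rewrite /sub; ring.
have subK : curve_in K (gamma \o sub) by move=> t t01; exact/hgammaK/sub01.
have sub0 : sub 0 = x by rewrite /sub; ring.
have sub1 : sub 1 = 1 - x by rewrite /sub; ring.
have subh : sub 2^-1 = 2^-1 by rewrite /sub; lra.
have := hf geo subK half01; rewrite /= sub0 sub1 subh.
by rewrite (_ : 1 - 2^-1 = 2^-1 :> R) -?mulrDr//; lra.
Qed.

(** Adding h-convexity along [gamma] at [x] and at [1 - x] gives both end points the same
    coefficient. *)
Lemma hconvex_sum_sym x : x \in `[0, 1] ->
  f (gamma x) + f (gamma (1 - x)) <=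
  (f (gamma 0) + f (gamma 1)) * (h x + h (1 - x)).
Proof.
move=> x01; have x01' : 1 - x \in `[0, 1].
  by move: x01; rewrite !in_itv/= subr_ge0 => /andP[? ->]; rewrite lerBlDr lerDl.
have := hf hgamma hgammaK x01; have := hf hgamma hgammaK x01'.
by rewrite subKr; nra.
Qed.

End geodesic_hconvexity.

(** * The sum of the left-sided and the right-sided integral *)

Section katugampola_pair.
Context {R : realType}.
Notation mu := (@lebesgue_measure R).
Notation leb := (@completed_lebesgue_measure R).
Notation cR := (caratheodory_type (@wlength R idfun)^*%mu).
Implicit Types phi : R -> R.
Variables (alpha rho a b : R).
Hypotheses (rho0 : 0 < rho) (a0 : 0 <= a) (ab : a < b) (b1 : b <= 1).

Let c := (1 - a `^ rho) `^ rho^-1.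
Let s := (1 - b `^ rho) `^ rho^-1.

Definition katugampola_weight (t : R) : R :=
  t `^ (rho - 1) * (b `^ rho - t `^ rho) `^ (alpha - 1).

(** The fractional integrals are taken over closed intervals, the substitution over open ones; the
    end points form a null set. *)
Lemma completed_integral_itv_oo x y (g : R -> \bar R) :
  leb.-integrable `[x, y] g ->
  leb.-integrable `]x, y[ g /\
  (\int[leb]_(t in `[x, y]) g t = \int[leb]_(t in `]x, y[) g t)%E.
Proof.
move=> gi.
have moo : measurable (`]x, y[%classic : set cR) by exact: measurable_completed.
have mcc : measurable (`[x, y]%classic : set cR) by exact: measurable_completed.
have mN : measurable ([set x; y] : set cR).
  by apply: measurable_completed; apply: measurableU; exact: measurable_set1.
split.
  by apply: (integrableS mcc moo _ gi) => t; exact: subset_itv_oo_cc.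
rewrite (negligible_integral mN mcc gi); last first.
  transitivity (mu [set x; y]) => //.
  by apply: countable_lebesgue_measure0; exact: finite_set_countable.
congr (integral _ _ _); apply/seteqP; split => t /=; rewrite !in_itv/=.
  move=> [/andP[xt ty]] /not_orP[/eqP tx /eqP ty'].
  by rewrite !lt_neqAle xt ty eq_sym tx ty'.
move=> /andP[xt ty]; rewrite !ltW//; split => //.
by case=> te; move: xt ty; rewrite te ltxx.
Qed.

Let bC : b `^ rho <= 1.
Proof.
have -> : 1 = 1 `^ rho :> R by rewrite powR1.
apply: ge0_ler_powR => //; rewrite ?nnegrE ?ler01//; first exact: ltW.
by apply: le_trans (ltW ab).
Qed.

Let ab_gt0 t : t \in `]a, b[ -> 0 < t /\ t `^ rho < b `^ rho.
Proof.
rewrite in_itv/= => /andP[at_ tb]; have t0 : 0 < t by exact: le_lt_trans at_.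
by split=> //; rewrite ltr_powR2r ?ltW// (lt_trans t0).
Qed.

Let left_integrandE phi t :
  katugampola_left_integrand rho alpha (fun u => phi (u `^ rho)) b t =
  katugampola_weight t * phi (t `^ rho).
Proof.
by rewrite /katugampola_left_integrand /katugampola_weight -powRN opprB.
Qed.

(** At the substituted point p one has p^rho = 1 - t^rho, hence p^rho - s^rho = b^rho - t^rho. The
    factor p^(rho - 1) cancels against the power of 1 - t^rho in the Jacobian, and the constant
    [rho^-1 * rho] is 1. *)
Let right_integrandE phi t : t \in `]a, b[ ->
  katugampola_right_integrand rho alpha (fun u => phi (u `^ rho)) s
    (subst_powR 1 rho rho^-1 t) * subst_powR_jac 1 rho rho^-1 t =
  katugampola_weight t * phi (1 - t `^ rho).
Proof.
move=> /ab_gt0[t0 tb].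
have rho_neq0 : rho != 0 by rewrite gt_eqF.
have y0 : 0 < 1 - t `^ rho by rewrite subr_gt0; exact: lt_le_trans bC.
have sE : s `^ rho = 1 - b `^ rho by apply: powRVK; rewrite ?subr_ge0.
have psiE : subst_powR 1 rho rho^-1 t `^ rho = 1 - t `^ rho.
  exact: powRVK (ltW y0).
have psiE1 : subst_powR 1 rho rho^-1 t `^ (rho - 1) =
    ((1 - t `^ rho) `^ (rho^-1 - 1))^-1.
  rewrite /subst_powR -powRrM -powRN; congr (_ `^ _).
  by rewrite mulrBr mulVf// mulr1 opprB.
rewrite /katugampola_right_integrand /katugampola_weight /subst_powR_jac.
move: sE psiE psiE1; move: (subst_powR _ _ _ t) (s) => p s' -> -> ->.
rewrite (_ : 1 - t `^ rho - _ = b `^ rho - t `^ rho); last by ring.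
rewrite -(powRN _ (1 - alpha)) opprB mulVf// mul1r.
set Y := (1 - t `^ rho) `^ (rho^-1 - 1).
have Y0 : Y != 0 by rewrite gt_eqF// powR_gt0.
set D := _ `^ (alpha - 1); set T := t `^ (rho - 1).
move: (phi _) => r; clearbody Y D T.
by field.
Qed.

(** Besides the formula, the integrability of the combined integrand is recorded, since comparing
    two such integrals pointwise requires it. *)
Lemma katugampola_pair phi :
  katugampola_left_exists rho alpha a (fun u => phi (u `^ rho)) b ->
  katugampola_right_exists rho alpha c (fun u => phi (u `^ rho)) s ->
  leb.-integrable `]a, b[ (EFin \o (fun t =>
    katugampola_weight t * (phi (t `^ rho) + phi (1 - t `^ rho)))) /\
  \int[leb]_(t in `[a, b])
     katugampola_left_integrand rho alpha (fun u => phi (u `^ rho)) b t +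
  \int[leb]_(t in `[s, c])
     katugampola_right_integrand rho alpha (fun u => phi (u `^ rho)) s t =
  \int[leb]_(t in `]a, b[)
     (katugampola_weight t * (phi (t `^ rho) + phi (1 - t `^ rho))).
Proof.
move=> /completed_integral_itv_oo[li lE] /completed_integral_itv_oo[ri rE].
have moo : measurable (`]a, b[%classic : set cR) by exact: measurable_completed.
have rho0' : 0 < rho^-1 by rewrite invr_gt0.
have [ri' rE'] := completed_powR_substitution rho0 rho0' a0 ab bC ri.
have {}ri : leb.-integrable `]a, b[
    (EFin \o (fun t => katugampola_weight t * phi (1 - t `^ rho))).
  apply: eq_integrable ri' => // t /[!inE]/= tab.
  by rewrite -right_integrandE.
have {}li : leb.-integrable `]a, b[
    (EFin \o (fun t => katugampola_weight t * phi (t `^ rho))).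
  by apply: eq_integrable li => // t _; rewrite /= left_integrandE.
split.
  apply: eq_integrable (integrableD moo li ri) => // t _.
  by rewrite /= mulrDr.
rewrite /Rintegral lE rE rE'.
rewrite (@eq_integral _ cR _ leb _
  (fun t => (katugampola_weight t * phi (t `^ rho))%:E)); last by move=> t _; rewrite /= left_integrandE.
rewrite (@eq_integral _ cR _ leb _
  (fun t => (katugampola_weight t * phi (1 - t `^ rho))%:E) (fun t => _ * _)%E); last by move=> t /[!inE]/= tab; rewrite -right_integrandE.
rewrite -fineD ?(integrable_fin_num moo)//; congr fine.
rewrite -(integralD moo li ri); apply: eq_integral => t _.
by rewrite -EFinD -mulrDr.
Qed.

End katugampola_pair.

(** The weight is Borel, so its completed integral is the Lebesgue one; being nonnegative, it is
    integrable because that value is finite. *)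
Lemma completed_katugampola_weight (R : realType) (alpha rho a b : R) :
  0 < alpha -> 0 < rho -> 0 <= a -> a < b ->
  (@completed_lebesgue_measure R).-integrable `]a, b[
    (EFin \o katugampola_weight alpha rho b) /\
  \int[@completed_lebesgue_measure R]_(t in `]a, b[)
    katugampola_weight alpha rho b t =
  (b `^ rho - a `^ rho) `^ alpha / (alpha * rho).
Proof.
move=> alpha0 rho0 a0 ab.
have mw : measurable_fun `]a, b[ (EFin \o katugampola_weight alpha rho b).
  apply/measurable_EFinP; apply: measurable_funM.
    by apply: measurable_funTS; exact: measurable_powR.
  apply: measurable_funTS; apply: (measurableT_comp (measurable_powR _)).
  by apply: measurable_funB => //; exact: measurable_powR.
have wE := integral_katugampola_weight rho0 alpha0 a0 ab.
split; last by rewrite /Rintegral completed_integralE// wE.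
apply/completed_integrableE => //; apply/integrableP; split => //.
apply: (@le_lt_trans _ _ (((b `^ rho - a `^ rho) `^ alpha / (alpha * rho))%:E)%E);
  last exact: ltry.
rewrite -wE le_eqVlt; apply/orP; left; apply/eqP; apply: eq_integral => t _.
by rewrite gee0_abs// lee_fin mulr_ge0 ?powR_ge0.
Qed.

(** * The two inequalities for the Katugampola integrals *)

Theorem theorem3p8 (R : realType) (alpha rho a b : R)
    (halpha : 0 < alpha) (hrho : 0 < rho)
    (ha : 0 <= a) (hab : a < b) (hb : b <= 1)
    (M : metricType R) (hM : global_NPC M)
    (K : set M) (hK : geodesically_convex K)
    (h : R -> R) (hh : forall x, 0 < h x)
    (f : M -> R) (hf : geodesically_hconvex h K f)
    (gamma : R -> M) (hgamma : geodesic gamma) (hgammaK : curve_in K gamma) :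
  let c := (1 - a `^ rho) `^ rho^-1 in
  let s := (1 - b `^ rho) `^ rho^-1 in
  let F := fun u : R => f (gamma (u `^ rho)) in
  let H := fun u : R => h (u `^ rho) in
  katugampola_left_exists rho alpha a F b ->
  katugampola_right_exists rho alpha c F s ->
  katugampola_left_exists rho alpha a H b ->
  katugampola_right_exists rho alpha c H s ->
  f (gamma (2^-1)) <=
    rho `^ alpha * Gamma (alpha + 1) / (b `^ rho - a `^ rho) `^ alpha *
    h (2^-1) *
    (katugampola_left rho alpha a F b + katugampola_right rho alpha c F s)
  /\
  rho `^ alpha * Gamma (alpha + 1) / (b `^ rho - a `^ rho) `^ alpha *
    h (2^-1) *
    (katugampola_left rho alpha a F b + katugampola_right rho alpha c F s)
  <=
  (f (gamma 0) + f (gamma 1)) / (b `^ rho - a `^ rho) `^ alpha *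
    rho `^ alpha * Gamma (alpha + 1) * h (2^-1) *
    (katugampola_left rho alpha a H b + katugampola_right rho alpha c H s).
Proof.
move=> c s F H lF rF lH rH.
(* The pair formula is used for [f \o gamma] and then for [h]. *)
have [iF SF] := @katugampola_pair R alpha rho a b hrho ha hab hb
  (f \o gamma) lF rF.
have [iH SH] := @katugampola_pair R alpha rho a b hrho ha hab hb h lH rH.
have [iw Sw] := completed_katugampola_weight halpha hrho ha hab.
have mab : measurable (`]a, b[%classic :
    set (caratheodory_type (@wlength R idfun)^*%mu)).
  exact: measurable_completed.
have h0 := hh 2^-1.
have ab_itv t : t \in `]a, b[ -> t `^ rho \in `[0, 1].
  rewrite !in_itv/= powR_ge0/= => /andP[at_ tb].
  have -> : 1 = 1 `^ rho :> R by rewrite powR1.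
  apply: ge0_ler_powR; rewrite ?nnegrE ?ler01//; first exact: ltW.
    by apply: le_trans ha _; exact: ltW.
  by apply: le_trans hb; exact: ltW.
have w0 t : 0 <= katugampola_weight alpha rho b t by rewrite mulr_ge0 ?powR_ge0.
(* The midpoint inequality, divided by [h 2^-1 > 0], bounds a constant; integrated against the
   weight it produces the total mass. *)
have lower : f (gamma 2^-1) / h 2^-1 *
    ((b `^ rho - a `^ rho) `^ alpha / (alpha * rho)) <=
    \int[@completed_lebesgue_measure R]_(t in `]a, b[)
     (katugampola_weight alpha rho b t *
       ((f \o gamma) (t `^ rho) + (f \o gamma) (1 - t `^ rho))).
  rewrite -Sw -RintegralZl//; apply: le_Rintegral => //.
    by apply: eq_integrable (integrableZl mab (f (gamma 2^-1) / h 2^-1) iw).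
  move=> t /ab_itv t01; rewrite mulrC ler_wpM2l// ler_pdivrMr// mulrC.
  exact: (hconvex_midpoint hf).
have upper : \int[@completed_lebesgue_measure R]_(t in `]a, b[)
     (katugampola_weight alpha rho b t *
       ((f \o gamma) (t `^ rho) + (f \o gamma) (1 - t `^ rho))) <=
    (f (gamma 0) + f (gamma 1)) * \int[@completed_lebesgue_measure R]_(t in `]a, b[)
     (katugampola_weight alpha rho b t * (h (t `^ rho) + h (1 - t `^ rho))).
  rewrite -RintegralZl//; apply: le_Rintegral => //.
    by apply: eq_integrable (integrableZl mab (f (gamma 0) + f (gamma 1)) iH).
  move=> t /ab_itv t01; rewrite mulrCA ler_wpM2l//.
  exact: (hconvex_sum_sym hf).
rewrite /katugampola_left /katugampola_right -!mulrDr.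
rewrite {}SF {}SH GammaD1//.
move: lower upper; set IF := Rintegral _ _ _; set IH := Rintegral _ _ _.
have G0 := Gamma_gt0 halpha.
have V0 : 0 < (b `^ rho - a `^ rho) `^ alpha.
  rewrite powR_gt0// subr_gt0 ltr_powR2r//; apply: le_trans ha _; exact: ltW.
have PE : rho `^ alpha * rho `^ (1 - alpha) = rho.
  rewrite -powRD; first by rewrite subrKC powRr1// ltW.
  by rewrite (gt_eqF hrho) implybT.
have rho_neq0 : rho != 0 by rewrite gt_eqF.
(* Powers and values of functions become variables, so that the remaining identities are rational;
   [PE] keeps the relation between the two powers of [rho]. *)
move: (f (gamma _)) (f (gamma 0) + _) => f2 S.
move: (h _) h0 => h2 h20; move: (Gamma _) G0 => G G0.
move: (_ `^ alpha) V0 => V V0; move: (rho `^ (1 - alpha)) PE => P2 PE.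
move: (rho `^ alpha) PE => P1 PE.
have h2_neq0 : h2 != 0 by rewrite gt_eqF.
have alpha_neq0 : alpha != 0 by rewrite gt_eqF.
have G_neq0 : G != 0 by rewrite gt_eqF.
have V_neq0 : V != 0 by rewrite gt_eqF.

(* The values of Gamma cancel and the powers of [rho] multiply to [rho], which leaves one
   nonnegative constant for both inequalities. *)
have coefE I : P1 * (alpha * G) / V * h2 * (P2 / G * I) = h2 * alpha * rho / V * I.
  by rewrite -PE; field; rewrite ?V_neq0 ?G_neq0.
have coefE' I : S / V * P1 * (alpha * G) * h2 * (P2 / G * I) =
    h2 * alpha * rho / V * (S * I).
  by rewrite -PE; field; rewrite ?V_neq0 ?G_neq0.
have coef0 : 0 <= h2 * alpha * rho / V.
  by rewrite divr_ge0 ?(ltW V0)// !mulr_ge0// ltW.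
rewrite !coefE coefE' => lower upper; split; last exact: ler_wpM2l.
(* That constant is [h2] times the inverse of the total mass, so multiplying [lower] by it leaves
   exactly [f2] on the left. *)
apply: le_trans (ler_wpM2l coef0 lower); rewrite le_eqVlt; apply/orP; left.
by apply/eqP; field; rewrite ?V_neq0 ?alpha_neq0 ?rho_neq0 ?h2_neq0.
Qed.
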